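(* Consider the optimal promotion $\mathbf{s}^{\rm opt}=(s_p^{\rm opt},s_q^{\rm opt})$ in the Bass model on the homogeneous complete network as $M\to\infty$, with $p(s_p)=p_0+b_p\sqrt{s_p}$ and $q(s_q)=q_0+b_q\sqrt{s_q}$, and let $f^{\rm opt}$ be the corresponding adoption level. 1. If $T<\infty$, then $f^{\rm opt}(T)<1$, $s_p^{\rm opt}(T)>0$, and $s_q^{\rm opt}(T)>0$. 2. If $T=\infty$, then $\lim_{t\to\infty}f^{\rm opt}(t)=1$ and $\lim_{t\to\infty}s_p^{\rm opt}(t)=\lim_{t\to\infty}s_q^{\rm opt}(t)=0$.
   Context: In the limit $M\to\infty$, under a promotion $\mathbf{s}=(s_p,s_q)$ of piecewise-continuous functions $[0,T]\to[0,\infty)$, the expected adoption level $f$ solves $\frac{df}{dt}=(1-f)\big(p(s_p(t))+q(s_q(t))f\big)$, $f(0)=0$, and the optimal promotion maximizes $\Pi[\mathbf{s}]=\int_0^Te^{-\theta t}\big(\gamma\frac{df}{dt}-s_p(t)-s_q(t)\big)dt$. The optimal promotion is given by $$s_p^{\rm opt}(t)=\frac{b_p^2}{4}\big((1-f)(\Psi e^{\theta t}+\gamma)\big)^2,\qquad s_q^{\rm opt}(t)=\frac{b_q^2}{b_p^2}f^2s_p^{\rm opt}(t),$$ where $f=f^{\rm opt}$ and $\Psi$ solve, with $s_p=s_p^{\rm opt}$, $s_q=s_q^{\rm opt}$, the boundary-value problem $\frac{df}{dt}=(1-f)\big(p(s_p)+q(s_q)f\big)$, $f(0)=0$; $\frac{d\Psi}{dt}=(\gamma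 e^{-\theta t}+\Psi)\big(p(s_p)+q(s_q)(2f-1)\big)$, $\Psi(T)=0$. Here $p_0,q_0,b_p,b_q,\gamma>0$ are constants, $\theta\ge0$ is the discount rate (positive if $T=\infty$), and $T\in(0,\infty]$ is the planning horizon (if $T=\infty$, the terminal condition is understood as $t\to\infty$). *)

(* Defs.v *)
From HB Require Import structures.
From mathcomp Require Import all_boot all_order all_algebra.
From mathcomp Require Import all_classical all_reals all_analysis.
Set Implicit Arguments.
Unset Strict Implicit.
Unset Printing Implicit Defensive.
Import Order.TTheory GRing.Theory Num.Theory.
Import numFieldNormedType.Exports.
Local Open Scope classical_set_scope.
Local Open Scope ring_scope.

(* The horizon T ranges over the extended reals, so that T = +oo is allowed.
   Functions on [0, T] are total functions R -> R of which only the values on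
   [0, T] matter; for T = +oo the closed horizon is [0, +oo[. *)
Definition horizon (R : realType) (T : \bar R) : set R :=
  [set t | 0 <= t /\ (t%:E <= T)%E].

Definition open_horizon (R : realType) (T : \bar R) : set R :=
  [set t | 0 < t /\ (t%:E < T)%E].

(* Finitely many discontinuities in every bounded part of the horizon, and
   finite one-sided limits everywhere; the values at the two endpoints are
   unconstrained. *)
Definition piecewise_continuous (R : realType) (T : \bar R) (s : R -> R) : Prop :=
  [/\ forall x : R, finite_set
        [set t | [/\ open_horizon T t, t <= x & ~ {for t, continuous s}]],
      forall t : R, 0 <= t -> (t%:E < T)%E -> cvg (s @ t^'+) &
      forall t : R, 0 < t -> (t%:E <= T)%E -> cvg (s @ t^'-)].

Definition promotion (R : realType) (T : \bar R) (sp sq : R -> R) : Prop :=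
  [/\ piecewise_continuous T sp, piecewise_continuous T sq &
      forall t : R, horizon T t -> 0 <= sp t /\ 0 <= sq t].

Definition sqrt_response (R : realType) (a b s : R) : R := a + b * Num.sqrt s.

(* x is a solution of dx/dt = F driven by the piecewise-continuous promotion
   (sp, sq): it is continuous on the closed horizon and satisfies the equation
   at the interior points where the promotion does not jump. *)
Definition solves_ode (R : realType) (T : \bar R) (sp sq x F : R -> R) : Prop :=
  {within horizon T, continuous x} /\
  forall t : R, open_horizon T t ->
    {for t, continuous sp} -> {for t, continuous sq} ->
    is_derive t 1 x (F t).

Definition adoption_level (R : realType) (p q : R -> R) (T : \bar R)
    (sp sq f : R -> R) : Prop :=
  solves_ode T sp sq f
    (fun t => (1 - f t) * (p (sp t) + q (sq t) * f t)) /\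
  f 0 = 0.

(* A Lebesgue integral with values in \bar R.  For T = +oo the part containing
   df/dt is nonnegative and has finite integral, so the profit of an admissible
   promotion always makes sense, and is -oo when its cost is infinite.  The
   derivative may fail to exist only on a Lebesgue-null set. *)
Definition profit (R : realType) (gamma theta : R) (T : \bar R)
    (sp sq f : R -> R) : \bar R :=
  (\int[lebesgue_measure]_(t in horizon T)
     (expR (- theta * t) * (gamma * f^`()%classic t - sp t - sq t))%:E)%E.

Definition optimal_promotion (R : realType) (p q : R -> R) (gamma theta : R)
    (T : \bar R) (sp sq f : R -> R) : Prop :=
  [/\ promotion T sp sq, adoption_level p q T sp sq f &
      forall sp' sq' f' : R -> R,
        promotion T sp' sq' -> adoption_level p q T sp' sq' f' ->
        (profit gamma theta T sp' sq' f' <= profit gamma theta T sp sq f)%E].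

Definition terminal_zero (R : realType) (T : \bar R) (Psi : R -> R) : Prop :=
  match T with
  | r%:E => Psi r = 0
  | +oo%E => Psi t @[t --> +oo] --> (0 : R)
  | -oo%E => False
  end.

Definition adjoint_state (R : realType) (p q : R -> R) (gamma theta : R)
    (T : \bar R) (sp sq f Psi : R -> R) : Prop :=
  solves_ode T sp sq Psi
    (fun t => (gamma * expR (- theta * t) + Psi t) *
              (p (sp t) + q (sq t) * (2 * f t - 1))) /\
  terminal_zero T Psi.

(* Changing a promotion at a single time does not affect its profit, so
   maximality says nothing about, e.g., its value at t = T; the pointwise
   formula fixes the version meant by "the" optimal promotion. *)
Definition optimal_feedback (R : realType) (bp bq gamma theta : R)
    (T : \bar R) (sp sq f Psi : R -> R) : Prop :=
  forall t : R, horizon T t ->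
    sp t = bp ^+ 2 / 4 * ((1 - f t) * (Psi t * expR (theta * t) + gamma)) ^+ 2 /\
    sq t = bq ^+ 2 / bp ^+ 2 * f t ^+ 2 * sp t.

(* Main.v *)
(* The feedback formulas make (sp, sq) continuous, so both equations hold at
   every interior time.  Both 1 - f and f obey linear equations, which give
   0 < f < 1 for t > 0; at a finite T the terminal condition Psi(T) = 0 then makes
   sp(T) and sq(T) explicit positive numbers.  If T = +oo, p >= p0 gives
   1 - f <= exp(- p0 t).  Let W = gamma exp(- theta t) + Psi -> 0.  Once f > 1/2 we
   have W' = A W - theta gamma exp(- theta t) with A > 0, so a negative W would
   decrease and could not tend to 0; hence W >= 0.  Then Psi' = A W >= 0 and
   Psi -> 0 force Psi <= 0, so 0 <= Psi exp(theta t) + gamma <= gamma and sp -> 0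
   because 1 - f -> 0. *)

Require Import Defs.
From HB Require Import structures.
From mathcomp Require Import all_boot all_order all_algebra.
From mathcomp Require Import all_classical all_reals all_analysis.
From mathcomp Require Import ring lra.
Set Implicit Arguments.
Unset Strict Implicit.
Unset Printing Implicit Defensive.
Import Order.TTheory GRing.Theory Num.Theory.
Import numFieldNormedType.Exports.
Local Open Scope classical_set_scope.
Local Open Scope ring_scope.

(** * Exponential weights and monotonicity from the sign of a derivative *)

(** Integrating factor: the weight shifts the rate of a linear equation by [k], which later gives
    the derivative a definite sign. *)
Lemma is_derive_mulr_expR (R : realType) (u : R -> R) (k t du : R) :
  is_derive t 1 u du ->
  is_derive t 1 (fun s => u s * expR (k * s)) ((du + k * u t) * expR (k * t)).
Proof.
move=> hu; have he : is_derive t 1 (fun s => expR (k * s)) (expR (k * t) * k).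
  have hk : is_derive t 1 (fun s : R => k * s) k.
    by apply: (is_derive_eq (is_deriveZ k (is_derive_id t 1))); rewrite [LHS]mulr1.
  exact: (is_derive1_comp (is_derive_expR _) hk).
apply: (is_derive_eq (is_deriveM hu he)).
by rewrite /GRing.scale/=; ring.
Qed.

Lemma within_continuous_mulr_expR (R : realType) (A : set R) (u : R -> R)
    (k : R) :
  {within A, continuous u} ->
  {within A, continuous (fun s => u s * expR (k * s))}.
Proof.
move=> cu x; apply: cvgM; first exact: cu.
move: x; apply: continuous_subspaceT => x.
apply: (@continuous_comp _ _ _ (fun s => k * s) expR); last exact: continuous_expR.
exact: mulrl_continuous.
Qed.

Lemma derive_ge0_le (R : realType) (u du : R -> R) (a b : R) :
  a <= b -> {within `[a, b], continuous u} ->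
  (forall t, t \in `]a, b[ -> is_derive t 1 u (du t)) ->
  (forall t, t \in `]a, b[ -> 0 <= du t) -> u a <= u b.
Proof.
rewrite le_eqVlt => /predU1P[-> //|ab] cu hu du0.
have [c cab e] := MVT ab hu cu.
by rewrite -subr_ge0 e mulr_ge0 ?du0// subr_ge0 ltW.
Qed.

Lemma derive_gt0_lt (R : realType) (u du : R -> R) (a b : R) :
  a < b -> {within `[a, b], continuous u} ->
  (forall t, t \in `]a, b[ -> is_derive t 1 u (du t)) ->
  (forall t, t \in `]a, b[ -> 0 < du t) -> u a < u b.
Proof.
move=> ab cu hu du0; have [c cab e] := MVT ab hu cu.
by rewrite -subr_gt0 e mulr_gt0 ?du0// subr_gt0.
Qed.

(** * Sign and growth of solutions of linear equations *)

Lemma within_continuous_normr_bounded (R : realType) (c : R -> R) (a b : R) :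
  a <= b -> {within `[a, b], continuous c} ->
  exists K, forall t, t \in `[a, b] -> `|c t| <= K.
Proof.
move=> ab cc; have [|m mab hm] := @EVT_max _ (fun t => `|c t|) a b ab.
  by move=> x; apply: cvg_norm; exact: cc.
by exists `|c m|.
Qed.

(** A bound on [c] takes the place of its antiderivative in the usual exponential formula. Squaring
    [u] makes the derivative's sign independent of that of [u]; once zeros are excluded, the
    intermediate value theorem preserves the initial sign. *)
Lemma linear_ode_gt0 (R : realType) (u c : R -> R) (a b : R) :
  {within `[a, b], continuous u} -> {within `[a, b], continuous c} ->
  (forall t, t \in `]a, b[ -> is_derive t 1 u (c t * u t)) ->
  0 < u a -> forall t, t \in `[a, b] -> 0 < u t.
Proof.
move=> cu cc hu ua0 t /[!in_itv]/= /andP[at_ tb].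
have [K hK] := within_continuous_normr_bounded (le_trans at_ tb) cc.
have cu2 : {within `[a, b], continuous (fun s => u s * u s)}.
  by move=> x; apply: cvgM; exact: cu.
(* [(u^2 e^(2Kt))' = 2 (c + K) u^2 e^(2Kt) >= 0], so [u] never vanishes. *)
have nz s : s \in `[a, b] -> u s != 0.
  move=> /[!in_itv]/= /andP[as_ sb].
  suff: u a * u a * expR (2 * K * a) <= u s * u s * expR (2 * K * s).
    apply: contraTN => /eqP ->; rewrite !mul0r -ltNge.
    by rewrite !mulr_gt0// expR_gt0.
  apply: (@derive_ge0_le _ (fun s => u s * u s * expR (2 * K * s))
    (fun s => ((c s + c s) * (u s * u s) + 2 * K * (u s * u s)) * expR (2 * K * s))) => //.
  - apply: continuous_subspaceW (within_continuous_mulr_expR cu2).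
    by apply: subset_itvl; rewrite bnd_simp.
  - move=> x /[!in_itv]/= /andP[ax xs].
    apply: is_derive_mulr_expR.
    have hx : is_derive x 1 u (c x * u x).
      by apply: hu; rewrite in_itv/= ax (lt_le_trans xs).
    apply: (is_derive_eq (is_deriveM hx hx)).
    by rewrite /GRing.scale/=; ring.
  - move=> x /[!in_itv]/= /andP[ax xs].
    have /hK : x \in `[a, b] by rewrite in_itv/= (ltW ax) ltW// (lt_le_trans xs).
    rewrite ler_norml => /andP[Kx _].
    rewrite mulr_ge0 ?expR_ge0// -mulrDl mulr_ge0 ?sqr_ge0//.
    by lra.
rewrite ltNge; apply/negP => ut0.
have [||s sat us] := @IVT _ u a t 0 at_.
- by apply: continuous_subspaceW cu; apply: subset_itvl; rewrite bnd_simp.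
- by rewrite min_r ?max_l ?ut0 ?(ltW ua0)// (le_trans ut0)// ltW.
have : s \in `[a, b].
  by move: sat; rewrite !in_itv/= => /andP[-> /le_trans]; exact.
by move=> /nz; rewrite us eqxx.
Qed.

(** Excludes a positive slope at a minimum even when the minimum sits at the right end of its
    interval, where only points to the left are available. *)
Lemma derive_gt0_left_lt (R : realType) (u : R -> R) (du l c : R) :
  is_derive c 1 u du -> 0 < du -> l < c -> exists2 x, l < x < c & u x < u c.
Proof.
move=> [hu hdu] du0 lc.
have hlim : h^-1 *: ((u \o shift c) (h *: 1) - u c) @[h --> 0^'] --> du.
  by rewrite -hdu; exact: hu.
have hn : nbhs (0 : R)
    (fun h => h != 0 -> 0 < h^-1 *: ((u \o shift c) (h *: 1) - u c)).
  exact: (cvgr_gt _ hlim _ du0).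
have [e /= e0 he] := (nbhs_ballP _ _).1 hn.
(* The halves keep both constraints strict: [- h] lies in the ball of radius [e], and [c - h] stays
   to the right of [l]. *)
pose h := Num.min (e / 2) ((c - l) / 2).
have h0 : 0 < h by rewrite lt_min !divr_gt0// subr_gt0.
have hle : h <= e / 2 by rewrite ge_min lexx.
have hlc : h <= (c - l) / 2 by rewrite ge_min lexx orbT.
exists (c - h); first by apply/andP; split; lra.
have := he (- h); rewrite /ball/= sub0r opprK gtr0_norm// oppr_eq0 gt_eqF//.
have /[swap] /[apply] : h < e by lra.
rewrite [_%:A]mulr1 (addrC (- h)) => /(_ isT).
rewrite invrN scaleNr oppr_gt0 => hu0.
have hV : 0 < h^-1 by rewrite invr_gt0.
by rewrite -subr_lt0 -(pmulr_rlt0 _ hV).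
Qed.

(** Once [u >= 0] is known, [b + c * u] is positive and [u] strictly increases. For the sign, a
    weight with [K >= c] makes the rate [c - K] nonpositive, so a negative value of [u] can only
    push the derivative up. *)
Lemma linear_ode_increasing (R : realType) (u b c : R -> R) (l r : R) :
  {within `[l, r], continuous u} -> {within `[l, r], continuous c} ->
  (forall t, t \in `]l, r[ -> is_derive t 1 u (b t + c t * u t)) ->
  (forall t, t \in `]l, r[ -> 0 < b t) ->
  (forall t, t \in `]l, r[ -> 0 <= c t) ->
  0 <= u l -> forall t, l < t -> t <= r -> u l < u t.
Proof.
move=> cu cc hu b0 c0 ul0.
have u_ge0 s : s \in `]l, r[ -> 0 <= u s.
  move=> /[!in_itv]/= /andP[ls sr].
  have [K hK] := within_continuous_normr_bounded (ltW (lt_trans ls sr)) cc.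
  pose v s := u s * expR (- K * s).
  have cv : {within `[l, s], continuous v}.
    apply: continuous_subspaceW (within_continuous_mulr_expR cu).
    by apply: subset_itvl; rewrite bnd_simp ltW.
  (* Since [s < r], a minimum [m > l] lies inside []l, r[], where the equation holds; [m = s]
     remains possible. *)
  have [m /[!in_itv]/= /andP[lm ms] vm] := EVT_min (ltW ls) cv.
  rewrite -(pmulr_lge0 _ (expR_gt0 (- K * s))).
  apply: le_trans (vm s _); last by rewrite in_itv/= ltW/=.
  rewrite mulr_ge0 ?expR_ge0// leNgt; apply/negP => um0.
  have lm' : l < m.
    by rewrite lt_neqAle lm andbT; apply: contraTneq um0 => <-; rewrite -leNgt.
  have mr := le_lt_trans ms sr.
  have mi : m \in `]l, r[ by rewrite in_itv/= lm' mr.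
  (* At a negative minimum of [u e^(-Kt)] the derivative would be positive. *)
  have dv : is_derive m 1 v ((b m + c m * u m + - K * u m) * expR (- K * m)).
    exact/is_derive_mulr_expR/hu.
  have dv0 : 0 < (b m + c m * u m + - K * u m) * expR (- K * m).
    rewrite mulr_gt0 ?expR_gt0//.
    have /hK/(le_trans (ler_norm _)) : m \in `[l, r] by rewrite in_itv/= lm ltW.
    by move: (b0 _ mi); nra.
  have [x /andP[lx xm]] := derive_gt0_left_lt dv dv0 lm'.
  by rewrite ltNge vm// in_itv/= (ltW lx) (ltW (lt_le_trans xm ms)).
move=> t lt_ tr; apply: (derive_gt0_lt lt_ _ (du := fun t => b t + c t * u t)).
- by apply: continuous_subspaceW cu; apply: subset_itvl; rewrite bnd_simp.
- move=> s /[!in_itv]/= /andP[ls st]; apply: hu.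
  by rewrite in_itv/= ls (lt_le_trans st).
- move=> s /[!in_itv]/= /andP[ls st].
  have si : s \in `]l, r[ by rewrite in_itv/= ls (lt_le_trans st).
  by rewrite ltr_wpDr ?b0// mulr_ge0 ?c0 ?u_ge0.
Qed.

(** * Bounds on the adoption level *)

(** The gap [1 - f] starts at 1 and solves a homogeneous linear equation with rate
    [- (P + Q * f)]. *)
Lemma adoption_lt1 (R : realType) (P Q f : R -> R) (r : R) :
  {within `[0, r], continuous f} ->
  {within `[0, r], continuous P} -> {within `[0, r], continuous Q} ->
  (forall t, t \in `]0, r[ -> is_derive t 1 f ((1 - f t) * (P t + Q t * f t))) ->
  f 0 = 0 -> forall t, t \in `[0, r] -> f t < 1.
Proof.
move=> cf cP cQ hf f0 t tr; rewrite -subr_gt0.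
apply: (@linear_ode_gt0 _ (fun s => 1 - f s) (fun s => - (P s + Q s * f s)) 0 r) => //.
- by move=> x; apply: cvgB; [exact: cvg_cst|exact: cf].
- move=> x; apply: cvgN; apply: cvgD; first exact: cP.
  by apply: cvgM; [exact: cQ|exact: cf].
- move=> s sr; apply: (is_derive_eq (is_deriveB (is_derive_cst (1 : R) (s : R) 1) (hf s sr))).
  by ring.
- by rewrite f0 subr0.
Qed.

(** With the positive gap [1 - f] treated as a known coefficient, the equation is linear in [f],
    with forcing [(1 - f) * P > 0] and rate [(1 - f) * Q >= 0]. *)
Lemma adoption_gt0 (R : realType) (P Q f : R -> R) (r : R) :
  {within `[0, r], continuous f} ->
  {within `[0, r], continuous P} -> {within `[0, r], continuous Q} ->
  (forall t, t \in `]0, r[ -> is_derive t 1 f ((1 - f t) * (P t + Q t * f t))) ->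
  (forall t, t \in `[0, r] -> 0 < P t) -> (forall t, t \in `[0, r] -> 0 <= Q t) ->
  f 0 = 0 -> forall t, 0 < t -> t <= r -> 0 < f t.
Proof.
move=> cf cP cQ hf P0 Q0 f0 t t0 tr; rewrite -f0.
have g0 s : s \in `]0, r[ -> 0 < 1 - f s.
  by move=> sr; rewrite subr_gt0 (adoption_lt1 cf cP cQ hf)//; exact: subset_itv_oo_cc.
apply: (@linear_ode_increasing _ f (fun s => (1 - f s) * P s)
  (fun s => (1 - f s) * Q s) 0 r) => //.
- move=> x; apply: cvgM; last exact: cQ.
  by apply: cvgB; [exact: cvg_cst|exact: cf].
- by move=> s sr; apply: (is_derive_eq (hf s sr)); ring.
- by move=> s sr; apply: mulr_gt0; [exact: g0|apply/P0/subset_itv_oo_cc].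
- by move=> s sr; apply: mulr_ge0; [exact/ltW/g0|apply/Q0/subset_itv_oo_cc].
- by rewrite f0.
Qed.

(** The weighted function [(f - 1) e^(kt)] is nondecreasing, its derivative being
    [(1 - f) (P - k + Q f) e^(kt)]. *)
Lemma adoption_gap_le_expR (R : realType) (P Q f : R -> R) (k r : R) :
  {within `[0, r], continuous f} ->
  {within `[0, r], continuous P} -> {within `[0, r], continuous Q} ->
  (forall t, t \in `]0, r[ -> is_derive t 1 f ((1 - f t) * (P t + Q t * f t))) ->
  0 < k -> (forall t, t \in `[0, r] -> k <= P t) ->
  (forall t, t \in `[0, r] -> 0 <= Q t) ->
  f 0 = 0 -> 0 <= r -> 1 - f r <= expR (- (k * r)).
Proof.
move=> cf cP cQ hf k0 kP Q0 f0 r0.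
have P0 t : t \in `[0, r] -> 0 < P t by move/kP/(lt_le_trans k0).
suff : (f 0 - 1) * expR (k * 0) <= (f r - 1) * expR (k * r).
  rewrite mulr0 expR0 f0 sub0r mulr1 expRN -[_^-1]mul1r ler_pdivlMr ?expR_gt0//.
  by move=> h; lra.
apply: (@derive_ge0_le _ (fun s => (f s - 1) * expR (k * s))
  (fun s => ((1 - f s) * (P s + Q s * f s) + k * (f s - 1)) * expR (k * s))) => //.
- apply: within_continuous_mulr_expR => x.
  by apply: cvgB; [exact: cf|exact: cvg_cst].
- move=> s sr; apply: is_derive_mulr_expR.
  apply: (is_derive_eq (is_deriveB (hf s sr) (is_derive_cst (1 : R) (s : R) 1))).
  by rewrite subr0.
- move=> s sr; have sc : s \in `[0, r] by exact: subset_itv_oo_cc.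
  rewrite mulr_ge0 ?expR_ge0//.
  have -> : (1 - f s) * (P s + Q s * f s) + k * (f s - 1) =
    (1 - f s) * (P s - k + Q s * f s) by ring.
  have fs1 : f s < 1 by exact: (adoption_lt1 cf cP cQ hf).
  have fs0 : 0 < f s.
    move: sr; rewrite in_itv/= => /andP[s0 sr].
    exact: (adoption_gt0 cf cP cQ hf P0 Q0 f0 s0 (ltW sr)).
  apply: mulr_ge0; first by rewrite subr_ge0 ltW.
  by rewrite addr_ge0 ?subr_ge0 ?kP// mulr_ge0 ?Q0// ltW.
Qed.

(** * Continuity of the optimal promotion and of its responses *)

Lemma optimal_feedback_continuous (R : realType) (bp bq gamma theta : R)
    (T : \bar R) (sp sq f Psi : R -> R) :
  {within horizon T, continuous f} -> {within horizon T, continuous Psi} ->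
  optimal_feedback bp bq gamma theta T sp sq f Psi ->
  {within horizon T, continuous sp} /\ {within horizon T, continuous sq}.
Proof.
move=> cf cPsi fb.
have csp : {within horizon T, continuous sp}.
  apply: (@subspace_eq_continuous _ (horizon T) _ (fun t => bp ^+ 2 / 4 *
    ((1 - f t) * (Psi t * expR (theta * t) + gamma)) ^+ 2)).
    by move=> t /set_mem/fb[<- _].
  move=> x; apply: cvgM; first exact: cvg_cst.
  suff h : {for x, continuous (fun t : subspace (horizon T) =>
      (1 - f t) * (Psi t * expR (theta * t) + gamma))} by apply: cvgM; exact: h.
  apply: cvgM; first by apply: cvgB; [exact: cvg_cst|exact: cf].
  apply: cvgD; last exact: cvg_cst.
  exact: (within_continuous_mulr_expR cPsi).
split=> //.
apply: (@subspace_eq_continuous _ (horizon T) _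
  (fun t => bq ^+ 2 / bp ^+ 2 * (f t * f t) * sp t)).
  by move=> t /set_mem/fb[_]; rewrite expr2 => <-.
move=> x; apply: cvgM; last exact: csp.
by apply: cvgM; [exact: cvg_cst|apply: cvgM; exact: cf].
Qed.

Lemma sqrt_response_continuous (R : realType) (A : set R) (a b : R) (s : R -> R) :
  {within A, continuous s} ->
  {within A, continuous (fun t => sqrt_response a b (s t))}.
Proof.
move=> cs x; apply: cvgD; first exact: cvg_cst.
apply: cvgM; first exact: cvg_cst.
apply: (@cvg_comp _ _ _ s Num.sqrt); first exact: cs.
exact: sqrt_continuous.
Qed.

Lemma sqrt_response_ge (R : realType) (a b s : R) :
  0 <= b -> a <= sqrt_response a b s.
Proof. by move=> b0; rewrite /sqrt_response lerDl mulr_ge0// sqrtr_ge0. Qed.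

(** Continuity relative to the horizon is ordinary continuity at interior points, so no time is
    exempt from the equation. *)
Lemma solves_ode_is_derive (R : realType) (T : \bar R) (sp sq x F : R -> R) (r : R) :
  {within horizon T, continuous sp} -> {within horizon T, continuous sq} ->
  solves_ode T sp sq x F -> (r%:E <= T)%E ->
  forall t, t \in `]0, r[ -> is_derive t 1 x (F t).
Proof.
move=> csp csq [_ hx] rT t tr.
have /andP[t0 tr'] : 0 < t < r by rewrite in_itv in tr.
have sub : `[0, r] `<=` horizon T.
  move=> s /=; rewrite in_itv/= => /andP[s0 sr]; split=> //.
  by rewrite (le_trans _ rT)// lee_fin.
have cont (y : R -> R) : {within horizon T, continuous y} -> {for t, continuous y}.
  move=> hy; have cy : {within `[0, r], continuous y}.
    exact: continuous_subspaceW hy.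
  exact: (within_continuous_continuous (lt_trans t0 tr') cy tr).
apply: hx; [split=> //|exact: cont|exact: cont].
by rewrite (lt_le_trans _ rT)// lte_fin.
Qed.

(** * Sign information drawn from limits at infinity *)

Lemma derive_ge0_cvg_le (R : realType) (u du : R -> R) (l y : R) :
  (forall r, {within `[l, r], continuous u}) ->
  (forall t, l < t -> is_derive t 1 u (du t)) ->
  (forall t, l < t -> 0 <= du t) ->
  u t @[t --> +oo] --> y -> u l <= y.
Proof.
move=> cu hu du0 uy; apply: (cvgr_to_ge uy).
near=> t; have lt_ : l <= t by near: t; apply: nbhs_pinfty_ge; exact: num_real.
by apply: (derive_ge0_le lt_ (cu t) (du := du)) => s /[!in_itv]/= /andP[ls _];
  [exact: hu|exact: du0].
Unshelve. all: by end_near. Qed.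

(** If [w l < 0], then [- w] starts positive and has forcing [b > 0], so it increases; [w] then
    stays below [w l] and cannot tend to 0. *)
Lemma linear_ode_cvg0_ge0 (R : realType) (w b c : R -> R) (l : R) :
  (forall r, {within `[l, r], continuous w}) ->
  (forall r, {within `[l, r], continuous c}) ->
  (forall t, l < t -> is_derive t 1 w (c t * w t - b t)) ->
  (forall t, l < t -> 0 < b t) -> (forall t, l < t -> 0 <= c t) ->
  w t @[t --> +oo] --> (0 : R) -> 0 <= w l.
Proof.
move=> cw cc hw b0 c0 w0; rewrite leNgt; apply/negP => wl.
suff : 0 <= w l by rewrite leNgt wl.
apply: (cvgr_to_le w0).
near=> t; have lt_ : l < t by near: t; apply: nbhs_pinfty_gt; exact: num_real.
rewrite -lerN2 ltW//.
apply: (linear_ode_increasing (u := fun s => - w s) (b := b) (c := c)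
  (l := l) (r := t)) => //.
- by move=> x; apply: cvgN; exact: cw.
- move=> s /[!in_itv]/= /andP[ls _].
  by apply: (is_derive_eq (is_deriveN (hw s ls))); ring.
- by move=> s /[!in_itv]/= /andP[ls _]; exact: b0.
- by move=> s /[!in_itv]/= /andP[ls _]; exact: c0.
- by rewrite oppr_ge0 ltW.
Unshelve. all: by end_near. Qed.

Theorem corollary6 (R : realType) (p0 q0 bp bq gamma theta : R) (T : \bar R)
    (p0_gt0 : 0 < p0) (q0_gt0 : 0 < q0) (bp_gt0 : 0 < bp) (bq_gt0 : 0 < bq)
    (gamma_gt0 : 0 < gamma) (theta_ge0 : 0 <= theta)
    (T_gt0 : (0 < T)%E) (theta_gt0 : T = +oo%E -> 0 < theta)
    (p q : R -> R)
    (pE : p = sqrt_response p0 bp) (qE : q = sqrt_response q0 bq)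
    (sp sq f Psi : R -> R)
    (opt : optimal_promotion p q gamma theta T sp sq f)
    (adj : adjoint_state p q gamma theta T sp sq f Psi)
    (feedback : optimal_feedback bp bq gamma theta T sp sq f Psi) :
  (forall r : R, T = r%:E -> [/\ f r < 1, 0 < sp r & 0 < sq r]) /\
  (T = +oo%E ->
    [/\ f t @[t --> +oo] --> (1 : R),
        sp t @[t --> +oo] --> (0 : R) &
        sq t @[t --> +oo] --> (0 : R)]).
Proof.
have [_ [[cf odef] f0] _] := opt.
have [[cPsi odePsi] Psi_end] := adj.
have [csp csq] := optimal_feedback_continuous cf cPsi feedback.
have sub r : (r%:E <= T)%E -> `[0, r] `<=` horizon T.
  move=> rT s /=; rewrite in_itv/= => /andP[s0 sr]; split=> //.
  by rewrite (le_trans _ rT)// lee_fin.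
pose P (t : R) := p (sp t); pose Q (t : R) := q (sq t).
have p0P t : p0 <= P t by rewrite /P pE sqrt_response_ge// ltW.
have P0 t : 0 < P t by exact: lt_le_trans (p0P t).
have Q0 t : 0 <= Q t.
  by apply: le_trans (ltW q0_gt0) _; rewrite /Q qE sqrt_response_ge// ltW.
have cP : {within horizon T, continuous P}.
  by rewrite /P pE; exact: sqrt_response_continuous.
have cQ : {within horizon T, continuous Q}.
  by rewrite /Q qE; exact: sqrt_response_continuous.
have cW r (y : R -> R) : (r%:E <= T)%E -> {within horizon T, continuous y} ->
    {within `[0, r], continuous y}.
  by move=> /sub rT; exact: continuous_subspaceW.
have df (r t : R) : (r%:E <= T)%E -> t \in `]0, r[ ->
    is_derive t 1 f ((1 - f t) * (P t + Q t * f t)).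
  by move=> rT tr; exact: (solves_ode_is_derive csp csq (conj cf odef) rT tr).
have f_lt1 (r : R) : 0 <= r -> (r%:E <= T)%E -> f r < 1.
  move=> r0 rT.
  by apply: (adoption_lt1 (cW r _ rT cf) (cW r _ rT cP) (cW r _ rT cQ)) => //;
    [move=> t; exact: df|rewrite in_itv/= r0/=].
have f_gt0 (r : R) : 0 < r -> (r%:E <= T)%E -> 0 < f r.
  move=> r0 rT.
  by apply: (adoption_gt0 (cW r _ rT cf) (cW r _ rT cP) (cW r _ rT cQ)
    (r := r)) => //; move=> t; exact: df.
split=> [r rT|Ty].

  (* Finite horizon: values at the terminal time *)
  have r0 : 0 < r by rewrite -lte_fin -rT.
  have rT' : (r%:E <= T)%E by rewrite rT.
  have fr0 := f_gt0 r r0 rT'; have fr1 := f_lt1 r (ltW r0) rT'.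
  have [spE sqE] := feedback r (conj (ltW r0) rT').
  (* As [Psi r = 0], the feedback formula reduces to [bp ^+ 2 / 4 * ((1 - f r) * gamma) ^+ 2]. *)
  have spr : 0 < sp r.
    rewrite spE; move: Psi_end; rewrite rT/= => ->; rewrite mul0r add0r.
    by rewrite mulr_gt0 ?divr_gt0 ?exprn_gt0// mulr_gt0// subr_gt0.
  split=> //; rewrite sqE.
  by rewrite mulr_gt0// mulr_gt0 ?divr_gt0 ?exprn_gt0.

(* Infinite horizon: convergence of the adoption level *)
have rT r : (r%:E <= T)%E by rewrite Ty leey.
have th0 := theta_gt0 Ty.
have expR_cvg0 (k : R) : 0 < k -> expR (- (k * t)) @[t --> +oo] --> (0 : R).
  move=> k0; apply: (@cvg_comp _ _ _ (fun t => k * t) (fun t => expR (- t))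
    _ (pinfty_nbhs R)); last exact: cvgr_expR.
  exact/gt0_cvgMry.
have f_cvg : f t @[t --> +oo] --> (1 : R).
  have h : (1 - expR (- (p0 * t))) @[t --> +oo] --> (1 : R).
    by rewrite -[X in _ --> X]subr0; apply: cvgB; [exact: cvg_cst|exact: expR_cvg0].
  apply: squeeze_cvgr h (cvg_cst (1 : R)).
  near=> t; have t0 : 0 <= t by near: t; exact: nbhs_pinfty_ge.
  apply/andP; split; last exact: ltW (f_lt1 t t0 (rT t)).
  have : 1 - f t <= expR (- (p0 * t)); last by lra.
  by apply: (adoption_gap_le_expR (cW t _ _ cf) (cW t _ _ cP) (cW t _ _ cQ)) => //;
    move=> s; exact: df.

(* Infinite horizon: signs of [W] and [Psi] at late times *)
pose W (t : R) := gamma * expR (- theta * t) + Psi t.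
have dPsi (t : R) : 0 < t -> is_derive t 1 Psi (W t * (P t + Q t * (2 * f t - 1))).
  (* Any endpoint beyond [t] would do; [t + 1] makes [t] interior. *)
  move=> t0; apply: (solves_ode_is_derive csp csq (conj cPsi odePsi) (rT (t + 1))).
  by rewrite in_itv/= t0 ltrDl ltr01.
have PsiC : Psi t @[t --> +oo] --> (0 : R) by move: Psi_end; rewrite Ty.
have WC : W t @[t --> +oo] --> (0 : R).
  rewrite -[X in _ --> X]addr0; apply: cvgD => //.
  rewrite -[X in _ --> X](mulr0 gamma); apply: cvgM; first exact: cvg_cst.
  by under eq_fun do rewrite mulNr; exact: expR_cvg0.
have [t0 t0_gt0 f_half] : exists2 t0 : R, 0 < t0 & forall t : R, t0 <= t -> 1 / 2 < f t.
  have half : 1 / 2 < 1 :> R by lra.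
  have [M [_ hM]] := cvgr_gt _ f_cvg _ half.
  (* The bound on [f] holds strictly beyond [M], hence [M + 1]; the 1 makes [t0] positive, so the
     equations hold at all later times. *)
  exists (Num.max (M + 1) 1) => [|t]; first by rewrite lt_max ltr01 orbT.
  by rewrite ge_max => /andP[Mt _]; apply: hM; lra.
have A0 (t : R) : t0 <= t -> 0 < P t + Q t * (2 * f t - 1).
  move=> tt; rewrite ltr_wpDr// mulr_ge0//.
  by have := f_half t tt; lra.
have cT (x y : R) (h : R -> R) : t0 <= x -> {within horizon T, continuous h} ->
    {within `[x, y], continuous h}.
  move=> tx; apply: continuous_subspaceW => s /=; rewrite in_itv/= => /andP[xs _].
  by split=> //; rewrite (le_trans _ xs)// (le_trans _ tx)// ltW.
have W_ge0 (t : R) : t0 <= t -> 0 <= W t.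
  (* The forcing [b] is minus the derivative of [gamma * expR (- theta * s)]; it is positive because
     [theta > 0]. *)
  move=> tt; apply: (linear_ode_cvg0_ge0 (c := fun s => P s + Q s * (2 * f s - 1))
    (b := fun s => gamma * theta * expR (- theta * s)) _ _ _ _ _ WC).
  - move=> r; apply: (cT _ _ _ tt) => y; apply: cvgD; last exact: cPsi.
    apply: (within_continuous_mulr_expR (u := fun=> gamma)).
    by move=> z; exact: cvg_cst.
  - move=> r; apply: (cT _ _ _ tt) => y; apply: cvgD; first exact: cP.
    apply: cvgM; first exact: cQ.
    by apply: cvgB; [apply: cvgM; [exact: cvg_cst|exact: cf]|exact: cvg_cst].
  - move=> s ts; have s0 : 0 < s by exact: lt_trans (lt_le_trans t0_gt0 tt) ts.
    have dg : is_derive s 1 (fun s => gamma * expR (- theta * s))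
        ((0 + - theta * gamma) * expR (- theta * s)).
      exact: (@is_derive_mulr_expR _ (fun=> gamma) (- theta) s 0
        (is_derive_cst (gamma : R) (s : R) 1)).
    by apply: (is_derive_eq (is_deriveD dg (dPsi s s0))); ring.
  - by move=> s _; rewrite !mulr_gt0// expR_gt0.
  - by move=> s ts; rewrite ltW// A0// (le_trans tt)// ltW.
have Psi_le0 (t : R) : t0 <= t -> Psi t <= 0.
  move=> tt; apply: (derive_ge0_cvg_le (u := Psi)
    (du := fun s => W s * (P s + Q s * (2 * f s - 1))) _ _ _ PsiC).
  - by move=> r; exact: (cT _ _ _ tt cPsi).
  - move=> s ts; apply: dPsi; exact: lt_trans (lt_le_trans t0_gt0 tt) ts.
  - move=> s ts; have ts0 := le_trans tt (ltW ts).
    by rewrite mulr_ge0 ?W_ge0// ltW// A0.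
(* Convergence of [Psi] to 0 alone does not control [Psi t * expR (theta * t)]. The signs do:
   [L = W e^(theta t) >= 0], and [Psi <= 0] gives [L <= gamma]. *)
pose L (t : R) := Psi t * expR (theta * t) + gamma.
have L_bnd (t : R) : t0 <= t -> 0 <= L t <= gamma.
  move=> tt; apply/andP; split.
    have -> : L t = W t * expR (theta * t).
      by rewrite /L /W mulrDl -mulrA -expRD mulNr addNr expR0 mulr1 addrC.
    by rewrite mulr_ge0 ?W_ge0 ?expR_ge0.
  by rewrite gerDr mulr_le0_ge0 ?Psi_le0 ?expR_ge0.

(* Infinite horizon: decay of the promotion *)
have gLC : (1 - f t) * L t @[t --> +oo] --> (0 : R).
  have h : (1 - f t) * gamma @[t --> +oo] --> (0 : R).
    rewrite -[X in _ --> X](mul0r gamma); apply: cvgM; last exact: cvg_cst.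
    by rewrite -(subrr (1 : R)); apply: cvgB => //; exact: cvg_cst.
  apply: squeeze_cvgr (cvg_cst (0 : R)) h.
  near=> t; have tt : t0 <= t by near: t; apply: nbhs_pinfty_ge; exact: num_real.
  have /andP[L0 Lg] := L_bnd t tt.
  have g0 : 0 <= 1 - f t.
    by rewrite subr_ge0 ltW// f_lt1// (le_trans _ tt)// ltW.
  by rewrite mulr_ge0//= ler_wpM2l.
(* The feedback formulas hold only for [t >= 0], hence eventually; squares become products so that
   limits of products apply. *)
have near_feedback : \forall t \near +oo,
    sp t = bp ^+ 2 / 4 * ((1 - f t) * L t * ((1 - f t) * L t)) /\
    sq t = bq ^+ 2 / bp ^+ 2 * (f t * f t) * sp t.
  near=> t; have t_ge0 : 0 <= t by near: t; exact: nbhs_pinfty_ge.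
  by have := feedback t (conj t_ge0 (rT t)); rewrite !expr2.
have spC : sp t @[t --> +oo] --> (0 : R).
  have h : bp ^+ 2 / 4 * ((1 - f t) * L t * ((1 - f t) * L t)) @[t --> +oo] -->
      bp ^+ 2 / 4 * (0 * 0 : R).
    by apply: cvgM; [exact: cvg_cst|exact: cvgM].
  rewrite mul0r mulr0 in h; apply: cvg_trans h; apply: near_eq_cvg.
  by apply: filterS near_feedback => t [->].
split=> //.
have h : bq ^+ 2 / bp ^+ 2 * (f t * f t) * sp t @[t --> +oo] -->
    bq ^+ 2 / bp ^+ 2 * (1 * 1) * (0 : R).
  by apply: cvgM => //; apply: cvgM; [exact: cvg_cst|exact: cvgM].
rewrite mulr0 in h; apply: cvg_trans h; apply: near_eq_cvg.
by apply: filterS near_feedback => t [_ <-].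
Unshelve. all: by end_near. Qed.
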